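(* There is a dense set $\Delta\subset(0,1)$ with the following property. For each $\alpha\in\Delta$ there is a self-affine function $f_\alpha\in C^{\alpha}[0,1]$ such that for all $A\subset[0,1]$: (1) if $f_\alpha|_A$ is $\beta$-Hölder continuous for some $\beta>\alpha$, then $\overline{\dim}_{\mathcal M}A\le 1-\alpha$; (2) if $f_\alpha|_A$ is of bounded variation, then $\overline{\dim}_{\mathcal M}A\le\max\{1-\alpha,\alpha\}$.
   Context: Sets $A\subset[0,1]$ are arbitrary non-empty sets. A function $f\colon A\to\mathbb R$ is $\beta$-Hölder continuous if there is $c\in(0,\infty)$ with $|f(x)-f(y)|\le c|x-y|^{\beta}$ for all $x,y\in A$; $C^{\alpha}[0,1]$ is the set of $\alpha$-Hölder continuous functions $[0,1]\to\mathbb R$. A function $g\colon A\to\mathbb R$ is of bounded variation if $\sup\{\sum_{i=1}^{n}|g(x_i)-g(x_{i-1})|: x_0<\dots<x_n,\ x_i\in A,\ n\ge1\}<\infty$. A compact set $K\subset\mathbb R^2$ is self-affine if for some $M\ge2$ there are injective and contractive affine maps $F_1,\dots,F_M\colon\mathbb R^2\to\mathbb R^2$ such that $K=\bigcup_{i=1}^{M}F_i(K)$. A continuous function $f\colon[0,1]\to\mathbb R$ is self-affine if its graph is a self-affine set. $\overline{\dim}_{\mathcal M}$ is the upper Minkowski (upper box) dimension: for an integer $M\ge2$, $\overline{\dim}_{\mathcal M}A=\limsup_{n\to\infty}\frac{\log N_n(A,M)}{n\log M}$, where $N_n(A,M)$ is the number of intervals $[pM^{-n},(p+1)M^{-n})$,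 $p\in\{0,\dots,M^n-1\}$, that intersect $A$ (the value does not depend on $M$). *)

(* Defs.v *)
From HB Require Import structures.
From mathcomp Require Import all_boot all_order all_algebra.
From mathcomp Require Import all_classical all_reals all_analysis.

Set Implicit Arguments.
Unset Strict Implicit.
Unset Printing Implicit Defensive.

Import Order.TTheory GRing.Theory Num.Theory.
Import numFieldNormedType.Exports.

Local Open Scope classical_set_scope.
Local Open Scope ring_scope.

(* Functions on a subset A of R are represented by total functions R -> R of
   which only the values on A are used. *)

Definition holder_on (R : realType) (A : set R) (beta : R) (f : R -> R) : Prop :=
  exists2 c : R, 0 < c &
    forall x y, A x -> A y -> `|f x - f y| <= c * `|x - y| `^ beta.

Definition variations_on (R : realType) (A : set R) (g : R -> R) : set R :=
  [set v | exists (n : nat) (x : nat -> R),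
     [/\ (1 <= n)%N,
         forall i, (i <= n)%N -> A (x i),
         forall i, (i < n)%N -> x i < x i.+1 &
         v = \sum_(1 <= i < n.+1) `|g (x i) - g (x i.-1)|]].

Definition bounded_variation_on (R : realType) (A : set R) (g : R -> R) : Prop :=
  has_ubound (variations_on A g).

(* The norm that 'rV[R]_2 carries in the library is the sup norm, hence this
   separate definition; both induce the same topology. *)
Definition euclidean_norm (R : realType) (v : 'rV[R]_2) : R :=
  Num.sqrt (\sum_(i < 2) v 0 i ^+ 2).

Definition affine_map (R : realType) (F : 'rV[R]_2 -> 'rV[R]_2) : Prop :=
  exists (B : 'M[R]_2) (b : 'rV[R]_2), forall v, F v = v *m B + b.

Definition contractive (R : realType) (F : 'rV[R]_2 -> 'rV[R]_2) : Prop :=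
  exists2 c : R, c < 1 &
    forall u v, euclidean_norm (F u - F v) <= c * euclidean_norm (u - v).

Definition self_affine_set (R : realType) (K : set 'rV[R]_2) : Prop :=
  compact K /\
  exists (M : nat) (F : 'I_M -> 'rV[R]_2 -> 'rV[R]_2),
    [/\ (2 <= M)%N,
        forall i, [/\ affine_map (F i), injective (F i) & contractive (F i)] &
        K = \bigcup_(i in [set: 'I_M]) (F i @` K)].

Definition graph01 (R : realType) (f : R -> R) : set 'rV[R]_2 :=
  [set v | v 0 0 \in `[0, 1] /\ v 0 1 = f (v 0 0)].

Definition self_affine_function (R : realType) (f : R -> R) : Prop :=
  {within `[0, 1], continuous f} /\ self_affine_set (graph01 f).

Definition box_count (R : realType) (M : nat) (A : set R) (n : nat) : nat :=
  #|[pred p : 'I_(M ^ n) |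
      `[< exists2 x, A x & x \in `[p%:R / M%:R ^+ n, p.+1%:R / M%:R ^+ n[ >]]|.

(* Since ln 0 = 0, a set that meets no half-open interval (for non-empty
   A `<=` [0, 1], only A = [set 1]) gets dimension 0. The term n = 0 is a
   division by zero, which does not affect the limsup. *)
Definition upper_minkowski_dim (R : realType) (M : nat) (A : set R) : \bar R :=
  limn_esup (fun n : nat =>
    (ln (box_count M A n)%:R / (n%:R * ln M%:R))%:E).

(* Main.v *)
Require Import Defs.
From mathcomp Require Import all_boot all_order all_algebra.
From mathcomp Require Import all_classical all_reals all_analysis.
From mathcomp Require Import zify ring lra.

Set Implicit Arguments.
Unset Strict Implicit.
Unset Printing Implicit Defensive.

Import Order.TTheory GRing.Theory Num.Theory.
Import numFieldNormedType.Exports.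

Local Open Scope classical_set_scope.
Local Open Scope ring_scope.

(** Let n >= 2, let q be odd and put m = q n.  Divide the unit square into m
columns and n rows.  A path that sweeps the rows q times, alternately upwards
and downwards, crosses one column after the other and moves by one row at each
step; as q is odd it goes from the bottom left to the top right corner.
Replacing each step by an affine copy of the whole picture, turned upside down
on the downward sweeps, and iterating, one gets the graph of a self-affine
function, called snake below.  On a column of level k (of width m^-k) it
oscillates by n^-k, so it is Hoelder continuous with the exponent alpha for
which m^alpha = n.

The path stays exactly q times in each row.  Hence, at level s, each row of
height n^-s contains the graph over at most q^s of the m^s columns
(cell_row_fiber), and a set on which the snake oscillates by at most n^-s meets
at most 5 q^s columns of level s (oscillation_box_count).  The snake on a column
of level k is a copy of the snake shrunk by n^-k.  So, if N(k) is the number of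
columns of level k that meet A, then
  N(k + s) <= 5 q^s N(k) + m^s B(k, s)
where B(k, s) counts the columns of level k on which the restriction to A
oscillates by more than n^-(k + s) (box_count_refine).

If the restriction is beta-Hoelder with beta > alpha, then B(k, s) = 0 for large
k, because m^(- beta k) is eventually much smaller than n^-k
(holder_no_oscillation).  If its variation is at most V, then
B(k, s) <= V n^(k + s), because the columns are consecutive intervals
(oscillation_sum_le_variation).  The factor 5 is harmless as s can be taken
large: N(k) is at most a constant times m^(D k) for each D > 1 - alpha in the
first case, q being m^(1 - alpha), and for each D > max (1 - alpha, alpha) in
the second one, n being m^alpha (geometric_growth).  This bounds the dimension
computed in base m, and box_count_base_change carries it to every base.

For n = 3^p and m = 3^r the exponent alpha is p / r, so that all rational numbers
strictly between 0 and 1 are obtained. *)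

(** * Columns and rows of the sweeping path *)

Lemma sum_nat_mul_split (a b : nat) (F : nat -> nat) :
  (\sum_(0 <= i < a * b) F i
    = \sum_(0 <= i < a) \sum_(0 <= j < b) F (i * b + j))%N.
Proof.
rewrite big_nat_mul; apply: eq_bigr => i _.
rewrite -{1}[(i * b)%N]add0n mulSn big_addn addnK.
by apply: eq_bigr => j _; rewrite addnC.
Qed.

Lemma sum_eq_le1 (K v : nat) : (\sum_(0 <= p < K) (p == v) <= 1)%N.
Proof.
rewrite big_mkord; have [vK|Kv] := ltnP v K.
  rewrite (bigD1 (Ordinal vK)) //= eqxx big1 // => p /eqP pv.
  by apply/eqP; rewrite eqb0; apply/eqP => pE; apply: pv; exact: val_inj.
rewrite big1 // => p _; apply/eqP; rewrite eqb0; apply/eqP => pE.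
by have := ltn_ord p; rewrite pE ltnNge Kv.
Qed.

Section SnakeRows.
Variables (n q : nat).
Hypotheses (n_gt1 : (1 < n)%N) (q_gt0 : (0 < q)%N).
Local Notation m := (q * n)%N.

(** The row in which the path crosses column d: the sweep number d %/ n goes
downwards when it is odd. *)
Definition snake_row (d : nat) : nat :=
  if odd (d %/ n) then (n.-1 - d %% n)%N else (d %% n)%N.

(** The row of height n^-s that contains the graph over column i of level s.  The
leading digit d of i in base m selects a column of level 1, on which the picture
of level s - 1 is reproduced, upside down when d belongs to a downward sweep. *)
Fixpoint cell_row (s i : nat) : nat :=
  if s is s'.+1 then
    let d := (i %/ m ^ s')%N in let r := cell_row s' (i %% m ^ s') in
    (snake_row d * n ^ s' + if odd (d %/ n) then n ^ s' - 1 - r else r)%N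
  else 0%N.

Lemma snake_row_lt d : (snake_row d < n)%N.
Proof.
have n0 : (0 < n)%N by exact: ltnW.
rewrite /snake_row; case: odd; last by rewrite ltn_pmod.
by rewrite (leq_ltn_trans (leq_subr _ _)) // ltn_predL.
Qed.

Lemma cell_row_lt s i : (cell_row s i < n ^ s)%N.
Proof.
elim: s i => [|s IH] i //=.
set d := (i %/ m ^ s)%N; set r := cell_row s _.
have r_lt : (r < n ^ s)%N by exact: IH.
have : (snake_row d < n)%N by exact: snake_row_lt.
rewrite expnS -(leq_pmul2r (_ : 0 < n ^ s))%N; last by lia.
by rewrite mulSn; case: ifP => _; lia.
Qed.

(** Each of the q sweeps visits each row exactly once. *)
Lemma snake_row_fiber j :
  (\sum_(0 <= d < m) (snake_row d == j) <= q)%N.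
Proof.
rewrite sum_nat_mul_split -[leqRHS]muln1 -[X in (_ <= X * _)%N]subn0.
rewrite -sum_nat_const_nat; apply: leq_sum => l _.
have n0 : (0 < n)%N by exact: ltnW.
under eq_big_nat => b /andP[_ bn].
  rewrite /snake_row divnMDl // modnMDl divn_small // addn0 modn_small //.
  rewrite (_ : (_ == j) = (b == if odd l then (n.-1 - j)%N else j) && (j < n)%N).
  over.
  by case: odd; apply/eqP/andP => [|[/eqP]]; [split; [apply/eqP|]|..]; lia.
move: (if odd l then _ else j) => c.
apply: (@leq_trans (\sum_(0 <= b < n) (b == c)%N)).
  by apply: leq_sum => b _; case: (b == c); case: (j < n)%N.
exact: sum_eq_le1.
Qed.

(** The row fixes the row of the leading column, for which there are at most q
choices, and then the row of the remaining picture of level s - 1, since turning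
upside down is a bijection of the rows. *)
Lemma cell_row_fiber s j :
  (\sum_(0 <= i < m ^ s) (cell_row s i == j) <= q ^ s)%N.
Proof.
elim: s j => [|s IH] j.
  by rewrite expn0 big_nat1; case: eqP.
have ms0 : (0 < m ^ s)%N by rewrite expn_gt0 muln_gt0 q_gt0 (ltnW n_gt1).
have ns0 : (0 < n ^ s)%N by rewrite expn_gt0 ltnW.
rewrite expnS sum_nat_mul_split.
pose target d := if odd (d %/ n) then (n ^ s - 1 - j %% n ^ s)%N else (j %% n ^ s)%N.
apply: (@leq_trans (\sum_(0 <= d < m) (snake_row d == j %/ n ^ s) * q ^ s))%N.
  apply: leq_sum => d _.
  apply: (@leq_trans (\sum_(0 <= i < m ^ s)
      (snake_row d == j %/ n ^ s) * (cell_row s i == target d)))%N; last first.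
    by rewrite -big_distrr /= leq_mul2l IH orbT.
  rewrite !big_mkord; apply: leq_sum => i _; have im := ltn_ord i.
  rewrite /= divnMDl // divn_small // addn0 modnMDl modn_small //.
  have := cell_row_lt s i; move: (cell_row s i) => r rn.
  set e := if odd _ then (_ - _)%N else r.
  have e_lt : (e < n ^ s)%N by rewrite /e; case: odd => //; lia.
  case: eqP => [jE|//]; rewrite /target -jE.
  rewrite divnMDl // modnMDl divn_small // modn_small // addn0 eqxx mul1n.
  by rewrite lt0b /e; case: odd; apply/eqP; lia.
by rewrite -big_distrl /= expnS leq_mul2r snake_row_fiber orbT.
Qed.

End SnakeRows.

(** * Box counting *)

Section BoxCounting.
Variable R : realType.

Lemma powR_exprnV (x a : R) k : 0 <= x -> (x ^- k) `^ a = (x `^ a) ^- k.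
Proof.
move=> x0; rewrite -powR_inv1 ?exprn_ge0 // -powRrM mulN1r powRN.
by rewrite -powR_mulrn // powRAC powR_mulrn // powR_ge0.
Qed.

Lemma expr_ratio_lt (x y e : R) : 0 <= x -> x < y -> 0 < e ->
  exists k0, forall k, (k0 <= k)%N -> x ^+ k <= e * y ^+ k.
Proof.
move=> x0 xy e0; have y0 : 0 < y by exact: le_lt_trans xy.
have cv : (fun k => (x / y) ^+ k : R) @ \oo --> 0.
  apply: cvg_expr; rewrite ger0_norm ?divr_ge0 ?(ltW y0) //.
  by rewrite ltr_pdivrMr // mul1r.
have /cvgr0Pnorm_le /(_ _ e0) [k0 _ near_k0] := cv.
exists k0 => k /near_k0 /=; rewrite expr_div_n.
rewrite ger0_norm ?divr_ge0 ?exprn_ge0 ?(ltW y0) //.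
by rewrite ler_pdivrMr // exprn_gt0.
Qed.

Definition in_cell (b k i : nat) (x : R) : bool :=
  x \in `[i%:R / b%:R ^+ k, i.+1%:R / b%:R ^+ k[.

Definition meets_cell (b : nat) (A : set R) (k i : nat) : bool :=
  `[< exists2 x, A x & in_cell b k i x >].

Lemma box_countE b (A : set R) k :
  box_count b A k = (\sum_(0 <= i < b ^ k) meets_cell b A k i)%N.
Proof.
rewrite big_mkord /box_count -sum1_card big_mkcond.
by apply: eq_bigr => i _; rewrite unfold_in /= /meets_cell; case: asboolP.
Qed.

Lemma box_count_le b (A : set R) k : (box_count b A k <= b ^ k)%N.
Proof. by rewrite /box_count (leq_trans (max_card _)) // card_ord. Qed.

Lemma in_cellE b k i (x : R) : (0 < b)%N ->
  in_cell b k i x = (i%:R <= b%:R ^+ k * x < i.+1%:R).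
Proof.
move=> b0; have bk : 0 < b%:R ^+ k :> R by rewrite exprn_gt0 // ltr0n.
by rewrite /in_cell in_itv /= ler_pdivrMr // ltr_pdivlMr // mulrC.
Qed.

Lemma in_cell_dist (b k i : nat) (x y : R) : (0 < b)%N ->
  in_cell b k i x -> in_cell b k i y -> `|x - y| <= b%:R ^- k.
Proof.
move=> b0; rewrite !in_cellE // -natr1 => xi yi.
have bk : 0 < b%:R ^+ k :> R by rewrite exprn_gt0 // ltr0n.
rewrite -[leRHS]div1r ler_pdivlMr // -[X in _ * X](gtr0_norm bk) -normrM mulrC.
by rewrite mulrBr ler_norml; lra.
Qed.

(** The intervals of length M^-j that meet a given interval of length b^-k are
consecutive, and there are at most b + 2 of them because M^j / b^k <= b. *)
Lemma box_count_base_change (A : set R) (b M k j : nat) :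
  (0 < b)%N -> (0 < M)%N -> (M ^ j <= b ^ k.+1)%N ->
  (box_count M A j <= (b + 2) * box_count b A k)%N.
Proof.
move=> b0 M0 Mb.
have bk : 0 < b%:R ^+ k :> R by rewrite exprn_gt0 // ltr0n.
have bk0 : (0 < b ^ k)%N by rewrite expn_gt0 b0.
have Mj : 0 < M%:R ^+ j :> R by rewrite exprn_gt0 // ltr0n.
rewrite !box_countE big_distrr /=.
(* The first interval of length M^-j that can meet the interval i. *)
pose first i := ((M ^ j * i) %/ b ^ k)%N.
apply: (@leq_trans (\sum_(0 <= p < M ^ j) \sum_(0 <= i < b ^ k)
    \sum_(0 <= c < b + 2) meets_cell b A k i * (p == first i + c)))%N.
  rewrite [leqLHS]big_mkord [leqRHS]big_mkord; apply: leq_sum => p _.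
  case: (boolP (meets_cell M A j p)) => // /asboolP [x Ax].
  rewrite in_cellE // => /andP[px xp].
  have x0 : 0 <= x by rewrite -(pmulr_rge0 _ Mj); have := ler0n R p; lra.
  have x1 : x < 1.
    rewrite -(ltr_pM2l Mj) mulr1 (lt_le_trans xp) // -natrX ler_nat.
    exact: ltn_ord.
  have y0 : 0 <= b%:R ^+ k * x by rewrite mulr_ge0 // ltW.
  have := truncn_itv y0; set i := Num.truncn _ => /andP[ix xi].
  have ib : (i < b ^ k)%N by rewrite truncn_lt_nat // natrX gtr_pMr.
  have first_le : (first i <= p)%N.
    rewrite /first -ltnS ltn_divLR // -(ltr_nat R) !natrM !natrX.
    apply: (@le_lt_trans _ _ (M%:R ^+ j * (b%:R ^+ k * x))).
      by rewrite ler_pM2l.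
    by rewrite mulrCA [ltRHS]mulrC ltr_pM2l.
  have le_first : (p < first i + (b + 2))%N.
    have pi : (p * b ^ k < M ^ j * i + M ^ j)%N.
      rewrite addnC -mulnS -(ltr_nat R) !natrM !natrX.
      apply: (@le_lt_trans _ _ (M%:R ^+ j * x * b%:R ^+ k)).
        by rewrite ler_pM2r.
      by rewrite -mulrA ltr_pM2l // mulrC.
    rewrite -(ltn_pmul2r bk0) (leq_trans pi) //.
    apply: (@leq_trans ((first i).+1 * b ^ k + b * b ^ k)%N).
      by rewrite leq_add -?expnS // ltnW // ltn_ceil.
    by rewrite -mulnDl leq_mul2r addSnnS leq_add2l addn2 leqnSn orbT.
  rewrite big_mkord (bigD1 (Ordinal ib)) //= big_mkord.
  have cb : (p - first i < b + 2)%N by rewrite -(ltn_add2l (first i)) subnKC.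
  rewrite (bigD1 (Ordinal cb)) //= subnKC // eqxx muln1.
  rewrite (_ : meets_cell b A k i = true) //.
  by apply/asboolP; exists x => //; rewrite in_cellE // ix xi.
rewrite exchange_big_nat /= big_mkord [leqRHS]big_mkord; apply: leq_sum => i _.
rewrite exchange_big_nat /= mulnC.
case: (meets_cell b A k i); last by rewrite big1 // => c _; rewrite big1.
rewrite mul1n -[leqRHS]muln1 -[X in (_ <= X * _)%N]subn0 -sum_nat_const_nat.
apply: leq_sum => c _; under eq_bigr => p _ do rewrite mul1n.
exact: sum_eq_le1.
Qed.

Lemma limn_esup_le_near (u : nat -> \bar R) (y : \bar R) (N : nat) :
  (forall j, (N <= j)%N -> (u j <= y)%E) -> (limn_esup u <= y)%E.
Proof.
move=> u_le; apply: (@le_trans _ _ (ereal_sup [set u j | j in [set j | (N <= j)%N]])).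
  by apply: ereal_inf_lbound; exists [set j | (N <= j)%N] => //; exists N.
by apply: ub_ereal_sup => _ [j Nj <-]; exact: u_le.
Qed.

Lemma upper_minkowski_dim_le (A : set R) (b M : nat) (D C : R) :
  (1 < b)%N -> (2 <= M)%N -> 0 <= D -> 1 <= C ->
  (forall k, (box_count b A k)%:R <= C * (b%:R `^ D) ^+ k) ->
  (upper_minkowski_dim M A <= D%:E)%E.
Proof.
move=> b1 M2 D0 C1 box_le; have b0 : (0 < b)%N by exact: ltnW.
have M0 : (0 < M)%N by exact: ltnW.
have lnM_gt0 : 0 < ln M%:R :> R by rewrite ln_gt0 // ltr1n.
pose L : R := ln ((b + 2)%:R * C).
have CL1 : 1 <= (b + 2)%:R * C.
  by rewrite -[leLHS]mulr1 ler_pM // ler1n addn2.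
have L0 : 0 <= L by exact: ln_ge0.
apply/lee_addgt0Pr => e e0.
(* From this index on, the constant factor adds at most e to the quotient. *)
apply: (@limn_esup_le_near _ _ (Num.truncn (L / (e * ln M%:R))).+1) => j Nj.
have j0 : 0 < j%:R :> R by rewrite ltr0n (leq_trans _ Nj).
rewrite -EFinD lee_fin ler_pdivrMr ?mulr_gt0 //.
have Le : L <= e * (j%:R * ln M%:R).
  rewrite mulrCA -ler_pdivrMr ?mulr_gt0 //.
  have La : 0 <= L / (e * ln M%:R) by rewrite divr_ge0 // mulr_ge0 // ltW.
  have /andP[_ /ltW LN] := truncn_itv La.
  by apply: le_trans LN _; rewrite ler_nat.
have Dj0 : 0 <= D * (j%:R * ln M%:R).
  by rewrite !mulr_ge0 // ltW.
have [->|] := posnP (box_count M A j); first by rewrite ln0 // mulrDl; lra.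
rewrite -(ltr0n R) => box_pos.
pose k := trunc_log b (M ^ j).
have Mj0 : (0 < M ^ j)%N by rewrite expn_gt0 M0.
have /andP[bM Mb] := trunc_log_bounds b1 Mj0.
have box_ub : (box_count M A j)%:R <= (b + 2)%:R * C * (b%:R `^ D) ^+ k.
  apply: (@le_trans _ _ ((b + 2)%:R * (box_count b A k)%:R)).
    by rewrite -natrM ler_nat box_count_base_change // ltnW.
  by rewrite -mulrA ler_pM2l // ltr0n addn2.
have bD : 0 < (b%:R `^ D) ^+ k by rewrite exprn_gt0 // powR_gt0 // ltr0n.
apply: (@le_trans _ _ (ln ((b + 2)%:R * C * (b%:R `^ D) ^+ k))).
  by rewrite ler_ln // posrE // mulr_gt0 // (lt_le_trans ltr01).
rewrite lnM ?posrE // ?(lt_le_trans ltr01) // -/L.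
rewrite lnXn ?powR_gt0 ?ltr0n // ln_powR.
have lnbM : ln b%:R *+ k <= ln M%:R *+ j :> R.
  rewrite -!lnXn ?ltr0n // ler_ln ?posrE ?exprn_gt0 ?ltr0n //.
  by rewrite -!natrX ler_nat.
rewrite -[X in X *+ k]mulr1.
have : D * (ln b%:R *+ k) <= D * (ln M%:R *+ j) by rewrite ler_wpM2l.
rewrite mulr1 mulrnAr -[ln M%:R *+ j]mulr_natl mulrDl; lra.
Qed.

(** Since X / r > 1, a large s makes 5 r^s at most half of X^s, and the recursion then
preserves the bound N k <= C X^k, the other half paying for the term in W. *)
Lemma geometric_growth (N : nat -> nat) (b r : nat) (X : R) :
  (0 < b)%N -> (0 < r)%N -> r%:R < X ->
  (forall k, (N k <= b ^ k)%N) ->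
  (forall s, exists (W : R) (k0 : nat), 0 <= W /\ forall k, (k0 <= k)%N ->
     (N (k + s)%N)%:R <= 5 * r%:R ^+ s * (N k)%:R + W * X ^+ k) ->
  exists2 C : R, 1 <= C & forall k, (N k)%:R <= C * X ^+ k.
Proof.
move=> b0 r0 rX N_triv N_step.
have r1 : 1 <= r%:R :> R by rewrite ler1n.
have X1 : 1 <= X by lra.
have tenth : 0 < 10^-1 :> R by lra.
have [s0 s0P] := expr_ratio_lt (ler0n R r) rX tenth.
pose s := s0.+1.
have rs : 10 * r%:R ^+ s <= X ^+ s by have := s0P s (leqnSn s0); lra.
have [W [k0 [W0 step]]] := N_step s.
pose B : R := (b ^ (k0 + s))%:R.
have B1 : 1 <= B by rewrite ler1n expn_gt0 b0.
exists (B + 2 * W) => [|k]; first lra.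
have Xk1 j : 1 <= X ^+ j by exact: exprn_ege1.
elim/ltn_ind: k => k IH.
have [k_small|k_large] := ltnP k (k0 + s).
  apply: (@le_trans _ _ (B * 1)).
    by rewrite mulr1 ler_nat (leq_trans (N_triv k)) // leq_pexp2l // ltnW.
  by apply: ler_pM => //; lra.
have [j [jk0 jk ->]] : exists j, [/\ (k0 <= j)%N, (j < k)%N & k = (j + s)%N].
  have sk : (s <= k)%N by exact: leq_trans (leq_addl k0 s) k_large.
  exists (k - s)%N; rewrite subnK // leq_subRL // addnC; split=> //.
  by rewrite ltn_subrL (leq_trans _ sk).
apply: le_trans (step j jk0) _.
have IHj := IH j jk.
have Nj0 := ler0n R (N j).
have h1 : 5 * r%:R ^+ s * (N j)%:R <= (X ^+ s / 2) * ((B + 2 * W) * X ^+ j).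
  by apply: ler_pM => //; lra.
have h2 : W * X ^+ j <= W * X ^+ j * X ^+ s.
  by rewrite ler_peMr // mulr_ge0 // (le_trans ler01).
have h3 : 0 <= B * X ^+ j * X ^+ s.
  by rewrite !mulr_ge0 // ?(le_trans ler01) //; lra.
rewrite exprD; lra.
Qed.

(** Two points of A at which g differs by more than delta are chosen in each interval
selected by P.  As the intervals are consecutive, these pairs can be ordered into
one increasing sequence, whose variation is at least delta times their number. *)
Lemma oscillation_sum_le_variation (A : set R) (g : R -> R) (b k : nat)
    (V delta : R) (P : nat -> bool) (K : nat) :
  (0 < b)%N -> 0 <= V -> 0 <= delta ->
  (forall v, variations_on A g v -> v <= V) ->
  (forall i, P i -> exists x y, [/\ A x, A y, in_cell b k i x, in_cell b k i y
      & delta < `|g x - g y|]) ->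
  delta * (\sum_(0 <= i < K) P i)%:R <= V.
Proof.
move=> b0 V0 delta0 V_ub P_osc.
have bk : 0 < b%:R ^+ k :> R by rewrite exprn_gt0 // ltr0n.
have [->|[l [x [l1 Ax x_incr _ le_var]]]] :
    (\sum_(0 <= i < K) P i = 0)%N \/
    exists (l : nat) (x : nat -> R), [/\ (1 <= l)%N,
      forall i, (i <= l)%N -> A (x i),
      forall i, (i < l)%N -> x i < x i.+1,
      b%:R ^+ k * x l < K%:R &
      delta * (\sum_(0 <= i < K) P i)%:R
        <= \sum_(1 <= i < l.+1) `|g (x i) - g (x i.-1)|].
- elim: K => [|K IH]; first by left; rewrite big_geq.
  rewrite big_nat_recr //=; have [PK|_] := boolP (P K); last first.
    rewrite addn0; case: IH => [->|[l [x [l1 Ax x_incr xK le_var]]]]; [by left|right].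
    by exists l, x; split=> //; rewrite -natr1; lra.
  right; have [u [v [Au Av uK vK [uv guv]]]] : exists u v, [/\ A u, A v,
      K%:R <= b%:R ^+ k * u, b%:R ^+ k * v < K.+1%:R & u < v /\ delta < `|g v - g u|].
    have [u [v [Au Av]]] := P_osc _ PK; rewrite !in_cellE // => uK vK guv.
    have [uv|vu|uv] := ltgtP u v.
    - by exists u, v; rewrite distrC; split=> //; lra.
    - by exists v, u; split=> //; lra.
    - by move: guv; rewrite uv subrr normr0; lra.
  case: IH => [->|[l [x [l1 Ax x_incr xK le_var]]]].
    exists 1%N, (fun i => if i == 0%N then u else v); split=> //.
    - by move=> [|[|]].
    - by move=> [|].
    - by rewrite big_nat1 /= mulr1 ltW.
  pose x' i := if (i <= l)%N then x i else if i == l.+1 then u else v.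
  have x'1 : x' l.+1 = u by rewrite /x' ltnn eqxx.
  have x'2 : x' l.+2 = v by rewrite /x' ltnNge leqnSn /= gtn_eqF.
  have x'0 i : (i <= l)%N -> x' i = x i by rewrite /x' => ->.
  exists l.+2, x'; split=> //.
  - move=> i; rewrite leq_eqVlt => /orP[/eqP->|]; first by rewrite x'2.
    rewrite ltnS leq_eqVlt => /orP[/eqP->|il]; first by rewrite x'1.
    by rewrite x'0 //; exact: Ax.
  - move=> i; rewrite ltnS leq_eqVlt => /orP[/eqP->|]; first by rewrite x'1 x'2.
    rewrite ltnS leq_eqVlt => /orP[/eqP->|il]; last by rewrite !x'0 ?x_incr // ltnW.
    by rewrite x'1 x'0 // -(ltr_pM2l bk); lra.
  - by rewrite x'2.
  rewrite natrD mulrDr mulr1 big_nat_recr //= x'2 x'1.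
  apply: lerD; last exact: ltW.
  rewrite big_nat_recr //=; apply: le_trans le_var _.
  rewrite -[leLHS]addr0; apply: lerD; last exact: normr_ge0.
  apply: ler_sum_nat => i /andP[i1 il].
  by rewrite (x'0 i il) (x'0 i.-1 (leq_trans (leq_pred i) il)).
- by rewrite mulr0.
apply: le_trans le_var (V_ub _ _); exists l, x; split=> //.
Qed.

End BoxCounting.

(** * The snake function *)

Section Snake.
Variables (R : realType) (n q : nat).
Hypotheses (n_gt1 : (1 < n)%N) (q_odd : odd q).
Local Notation m := (q * n)%N.

Let n_gt0 : 0 < n%:R :> R.
Proof. by rewrite ltr0n ltnW. Qed.

Let n_neq0 : n%:R != 0 :> R.
Proof. by rewrite gt_eqF. Qed.

Let m_ge_n : (n <= m)%N.
Proof. by rewrite leq_pmull // odd_gt0. Qed.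

Let m_gt0 : 0 < m%:R :> R.
Proof. by rewrite ltr0n (leq_trans _ m_ge_n) // ltnW. Qed.

Let m_neq0 : m%:R != 0 :> R.
Proof. by rewrite gt_eqF. Qed.

Let m_gt1 : (1 < m)%N.
Proof. exact: leq_trans n_gt1 m_ge_n. Qed.

Definition flip (b : bool) (y : R) : R := if b then 1 - y else y.

(** The affine bijection from the unit interval of heights to the row that the path
visits in column d. *)
Definition branch (d : nat) (y : R) : R :=
  ((snake_row n d)%:R + flip (odd (d %/ n)) y) / n%:R.

Lemma flip01 b (y : R) : 0 <= y <= 1 -> 0 <= flip b y <= 1.
Proof. by rewrite /flip; case: b => //; lra. Qed.

Lemma flip_dist b y z : `|flip b y - flip b z| = `|y - z|.
Proof.
by rewrite /flip; case: b => //; rewrite opprB addrC addrA subrK distrC.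
Qed.

Lemma branch01 d (y : R) : 0 <= y <= 1 -> 0 <= branch d y <= 1.
Proof.
move=> /(flip01 (odd (d %/ n))) y01; rewrite /branch ler_pdivlMr // mul0r.
have := snake_row_lt n_gt1 d; rewrite -(ler_nat R) -natr1 ler_pdivrMr // mul1r.
have := ler0n R (snake_row n d); lra.
Qed.

Lemma branch_dist d y z : `|branch d y - branch d z| = `|y - z| / n%:R.
Proof.
rewrite /branch -mulrBl normrM normfV (gtr0_norm n_gt0).
by rewrite opprD addrACA subrr add0r flip_dist.
Qed.

(** The copies over consecutive columns fit together: within a sweep the path moves to
the adjacent row, and between two sweeps it stays in the same row and turns
round. *)
Lemma branch_join d : branch d 1 = branch d.+1 0.
Proof.
rewrite /branch; congr (_ / _); rewrite /snake_row.
have n0 : (0 < n)%N by exact: ltnW.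
have [a [b [bn ->]]] : exists a b, (b < n)%N /\ d = (a * n + b)%N.
  by exists (d %/ n)%N, (d %% n)%N; rewrite ltn_pmod // -divn_eq.
rewrite divnMDl // modnMDl divn_small // addn0 modn_small // -addnS.
rewrite divnMDl // modnMDl; move: bn; rewrite leq_eqVlt => /orP[/eqP bn|bn].
  rewrite bn divnn n0 modnn addn1 oddS /flip.
  have -> : n.-1 = b by rewrite -bn.
  by case: odd; rewrite /= ?subnn ?subn0 ?subr0 ?subrr.
rewrite divn_small // addn0 modn_small // /flip; case: odd.
  by rewrite subrr addr0 subr0 natr1; congr _%:R; lia.
by rewrite addr0 natr1.
Qed.

(** The formal column number m, just after the last one, opens a downward sweep
because q is odd; so the value 1 is reached at the right end without a separate
clause in the recursion below. *)
Lemma branch_last : branch m 0 = 1.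
Proof.
rewrite /branch /snake_row mulnK 1?ltnW // q_odd modnMl subn0 /flip subr0.
by rewrite natr1 prednK ?divff // ltnW.
Qed.

Fixpoint approx (k : nat) (x : R) : R :=
  if k is k'.+1 then
    let d := Num.truncn (m%:R * x) in branch d (approx k' (m%:R * x - d%:R))
  else 0.

Definition snake (x : R) : R := limn (approx^~ x).

Lemma approx01 k x : 0 <= approx k x <= 1.
Proof.
elim: k x => [|k IH] x /=; first by rewrite lexx ler01.
exact/branch01/IH.
Qed.

Lemma approx_step k x : `|approx k.+1 x - approx k x| <= n%:R ^- k.
Proof.
elim: k x => [|k IH] x.
  rewrite [approx 0 x]/= subr0 expr0 invr1.
  by have /andP[? ?] := approx01 1 x; rewrite ger0_norm.
set d := Num.truncn (m%:R * x); set t := m%:R * x - d%:R.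
rewrite [approx k.+2 x]/(branch d (approx k.+1 t)).
rewrite [approx k.+1 x]/(branch d (approx k t)).
by rewrite branch_dist ler_pdivrMr // exprSr invfM mulfVK.
Qed.

(** Consecutive approximations differ by at most n^-k <= 2 n^-k - 2 n^-(k + 1), so
approx k x - 2 n^-k is a bounded nondecreasing sequence. *)
Lemma approx_cvg x : approx^~ x @ \oo --> snake x.
Proof.
have n2 : 2 <= n%:R :> R by rewrite ler_nat.
have e_cvg : (fun k => 2 * n%:R ^- k : R) @ \oo --> 0.
  rewrite -[X in _ --> X](mulr0 2); apply: cvgMr.
  rewrite (_ : (fun k => _) = (fun k => n%:R^-1 ^+ k)).
    apply: cvg_expr; rewrite gtr0_norm ?invr_gt0 // invf_lt1 //; lra.
  by apply/funext => k; rewrite exprVn.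
have lo_cvg : cvgn (fun k => approx k x - 2 * n%:R ^- k).
  apply: nondecreasing_is_cvgn.
    apply/nondecreasing_seqP => k.
    have := approx_step k x; rewrite ler_norml => /andP[+ _].
    have e0 : 0 <= n%:R ^- k :> R by rewrite invr_ge0 exprn_ge0 // ltW.
    have : 2 * n%:R ^- k.+1 <= n%:R ^- k :> R.
      by rewrite exprS invfM mulrA ler_piMl // ler_pdivrMr // mul1r.
    lra.
  exists 1 => _ [k _ <-]; have := approx01 k x.
  have : 0 <= n%:R ^- k :> R by rewrite invr_ge0 exprn_ge0 // ltW.
  lra.
have := cvgD lo_cvg e_cvg; rewrite addr0 => cv.
have eq_approx : approx^~ x =
    (fun k => approx k x - 2 * n%:R ^- k) \+ (fun k => 2 * n%:R ^- k).
  by apply/funext => k /=; rewrite subrK.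
suff: cvgn (approx^~ x) by []; rewrite eq_approx; apply/cvg_ex; eexists; exact: cv.
Qed.

Lemma snake_eq x :
  snake x = branch (Num.truncn (m%:R * x))
                   (snake (m%:R * x - (Num.truncn (m%:R * x))%:R)).
Proof.
set d := Num.truncn (m%:R * x); set t := m%:R * x - d%:R.
have cS : (fun k => approx k.+1 x) @ \oo --> snake x.
  by have := @approx_cvg x; rewrite -(cvg_shiftS (approx^~ x)).
apply: (cvg_unique _ cS) => //=; rewrite -/d -/t.
rewrite /branch; apply: cvgMl; apply: cvgD; first exact: cvg_cst.
rewrite /flip; case: odd; last exact: approx_cvg.
by apply: cvgB; [exact: cvg_cst | exact: approx_cvg].
Qed.

Lemma snake01 x : 0 <= snake x <= 1.
Proof.
apply/andP; split.
  apply: limr_ge; first by apply/cvg_ex; exists (snake x); exact: approx_cvg.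
  by near=> k; case/andP: (approx01 k x).
apply: limr_le; first by apply/cvg_ex; exists (snake x); exact: approx_cvg.
by near=> k; case/andP: (approx01 k x).
Unshelve. all: by end_near. Qed.

Lemma snake0 : snake 0 = 0.
Proof.
have := snake_eq 0; rewrite mulr0 (@truncn_def _ 0 0) ?lexx ?ltr01// subr0.
rewrite /branch /snake_row div0n mod0n /= add0r.
have n2 : 2 <= n%:R :> R by rewrite ler_nat.
set y := snake 0 => y_eq.
have : y * (n%:R - 1) = 0 by rewrite mulrBr mulr1 {1}y_eq divfK // subrr.
by move/eqP; rewrite mulf_eq0 => /orP[/eqP//|/eqP]; lra.
Qed.

Lemma snake1 : snake 1 = 1.
Proof. by rewrite snake_eq mulr1 natrK subrr snake0 branch_last. Qed.

(** The self-similarity of the graph.  The functional equation snake_eq gives it for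
t < 1; for t = 1 the point belongs to the next column, and branch_join applies. *)
Lemma snake_branch d (t : R) : 0 <= t <= 1 ->
  snake ((d%:R + t) / m%:R) = branch d (snake t).
Proof.
case/andP=> t0; rewrite le_eqVlt => /orP[/eqP->|t1].
  rewrite snake1 branch_join natr1 snake_eq mulrC divfK //.
  by rewrite natrK subrr snake0.
rewrite snake_eq mulrC divfK // (@truncn_def _ _ d); first by rewrite addrC addKr.
by rewrite -natr1; lra.
Qed.

Lemma cell_exists k (x : R) : 0 <= x <= 1 ->
  exists (a : nat) (t : R), [/\ (a < m ^ k)%N, 0 <= t <= 1, (x < 1 -> t < 1)
    & x = (a%:R + t) / m%:R ^+ k].
Proof.
have mk0 : 0 < m%:R ^+ k :> R by rewrite exprn_gt0.
have mk0' : (0 < m ^ k)%N by rewrite -(ltr0n R) natrX.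
case/andP=> x0; rewrite le_eqVlt => /orP[/eqP->|x1].
  exists (m ^ k).-1, 1; rewrite ler01 lexx prednK // ltxx; split=> //.
  by rewrite natr1 prednK // natrX divff // gt_eqF.
have y0 : 0 <= x * m%:R ^+ k by rewrite mulr_ge0 // ltW.
exists (Num.truncn (x * m%:R ^+ k)), (x * m%:R ^+ k - (Num.truncn (x * m%:R ^+ k))%:R).
have := truncn_itv y0; rewrite -natr1 => ?.
split; [|lra|lra|].
  by rewrite truncn_lt_nat // natrX gtr_pMl.
by rewrite addrC subrK mulfK // gt_eqF.
Qed.

(** Every column of level k carries a copy of the snake shrunk by n^-k, up to a
translation and a reflection. *)
Lemma snake_cell k a (t u : R) : (a < m ^ k)%N -> 0 <= t <= 1 -> 0 <= u <= 1 ->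
  `|snake ((a%:R + t) / m%:R ^+ k) - snake ((a%:R + u) / m%:R ^+ k)|
    = `|snake t - snake u| / n%:R ^+ k.
Proof.
have mN0 : (0 < m)%N by rewrite -(ltr0n R).
elim: k a t u => [|k IH] a t u.
  by rewrite expn0 ltnS leqn0 => /eqP -> _ _; rewrite !expr0 !divr1 !add0r.
move=> ak t01 u01.
have split_cell (v : R) : (a%:R + v) / m%:R ^+ k.+1
    = ((a %/ m)%:R + ((a %% m)%:R + v) / m%:R) / m%:R ^+ k.
  have -> : a%:R = (a %/ m)%:R * m%:R + (a %% m)%:R :> R.
    by rewrite -natrM -natrD -divn_eq.
  rewrite exprS; move: m%:R m_neq0 => M M0.
  by field; rewrite M0 expf_neq0.
have sub01 (v : R) : 0 <= v <= 1 -> 0 <= ((a %% m)%:R + v) / m%:R <= 1.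
  move=> v01; rewrite ler_pdivlMr // ler_pdivrMr // mul0r mul1r.
  have : ((a %% m).+1 <= m)%N by rewrite ltn_mod.
  by rewrite -(ler_nat R) -natr1; have := ler0n R (a %% m); lra.
rewrite !split_cell IH ?sub01 //; last by rewrite ltn_divLR // -expnSr.
by rewrite !snake_branch // branch_dist exprS invfM mulrA.
Qed.

Lemma snake_cell_osc k a (t u : R) : (a < m ^ k)%N -> 0 <= t <= 1 -> 0 <= u <= 1 ->
  `|snake ((a%:R + t) / m%:R ^+ k) - snake ((a%:R + u) / m%:R ^+ k)|
    <= n%:R ^- k.
Proof.
move=> ak t01 u01; rewrite snake_cell // ler_piMl ?invr_ge0 ?exprn_ge0 ?(ltW n_gt0) //.
by have := snake01 t; have := snake01 u; rewrite ler_norml; lra.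
Qed.

(** Two points at distance at most m^-k lie in the same column of level k or in two
adjacent ones. *)
Lemma snake_modulus k (x y : R) : 0 <= x <= 1 -> 0 <= y <= 1 ->
  `|x - y| <= m%:R ^- k -> `|snake x - snake y| <= 2 * n%:R ^- k.
Proof.
wlog xy : x y / x <= y.
  move=> H x01 y01; have [/H|/ltW/H] := leP x y; first exact.
  by rewrite distrC [`|snake x - _|]distrC; exact.
move=> x01 y01; rewrite ler_distlC => /andP[_ yx].
have nk0 : 0 <= n%:R ^- k :> R by rewrite invr_ge0 exprn_ge0 // ltW.
have mk0 : 0 < m%:R ^+ k :> R by rewrite exprn_gt0.
have [x1|x1] := ltP x 1; last first.
  have -> : x = y by lra.
  by rewrite subrr normr0; lra.
have [a [t [ak t01 /(_ x1) t1 xE]]] := cell_exists k x01.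
have [yz|zy] := leP (y * m%:R ^+ k) (a%:R + 1).
  pose u := y * m%:R ^+ k - a%:R.
  have yE : y = (a%:R + u) / m%:R ^+ k by rewrite addrC subrK mulfK // gt_eqF.
  have u0 : t <= u.
    by move: xy; rewrite xE yE ler_pM2r ?invr_gt0 // lerD2l.
  have u01 : 0 <= u <= 1 by rewrite /u in u0 *; lra.
  by rewrite xE yE (le_trans (snake_cell_osc ak t01 u01)) //; lra.
pose u := y * m%:R ^+ k - (a%:R + 1).
have yE : y = (a.+1%:R + u) / m%:R ^+ k.
  by rewrite -natr1 addrC subrK mulfK // gt_eqF.
have ak1 : (a.+1 < m ^ k)%N.
  rewrite -(ltr_nat R) natrX -natr1 (lt_le_trans zy) //.
  by rewrite ler_piMl ?(ltW mk0) //; lra.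
have u01 : 0 <= u <= 1.
  rewrite /u; apply/andP; split; first lra.
  have : y * m%:R ^+ k <= (x + m%:R ^- k) * m%:R ^+ k by rewrite ler_pM2r.
  rewrite mulrDl mulVf ?gt_eqF // xE divfK ?gt_eqF //; lra.
rewrite [y]yE xE.
apply: le_trans (ler_distD (snake ((a%:R + 1) / m%:R ^+ k)) _ _) _.
have z01 : 0 <= (0 : R) <= 1 by rewrite lexx ler01.
have o01 : 0 <= (1 : R) <= 1 by rewrite lexx ler01.
rewrite mulr_natl mulr2n; apply: lerD; first exact: snake_cell_osc ak t01 o01.
by have := snake_cell_osc ak1 z01 u01; rewrite addr0 natr1.
Qed.

Lemma snake_holder (alpha : R) : 0 <= alpha -> m%:R `^ alpha = n%:R ->
  holder_on `[0, 1] alpha snake.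
Proof.
move=> a0 mn; exists (2 * n%:R); first by rewrite mulr_gt0.
move=> x y; rewrite /= !in_itv /= => x01 y01.
have [->|xy] := eqVneq x y.
  by rewrite !subrr normr0 mulr_ge0 ?powR_ge0 // ltW // mulr_gt0.
have d0 : 0 < `|x - y| by rewrite normr_gt0 subr_eq0.
have m2 : 2 <= m%:R :> R by rewrite ler_nat (leq_trans _ m_ge_n).
have ex : exists k, m%:R ^- k < `|x - y|.
  have cv : (fun k => m%:R^-1 ^+ k : R) @ \oo --> 0.
    apply: cvg_expr; rewrite gtr0_norm ?invr_gt0 // invf_lt1 //; lra.
  have /cvgr0Pnorm_lt /(_ _ d0) [k _ /(_ k (leqnn k))] := cv.
  by rewrite exprVn gtr0_norm ?invr_gt0 ?exprn_gt0 // => ?; exists k.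
(* The k + 1 found here satisfies m^-(k + 1) < |x - y| <= m^-k. *)
case: (ex_minnP ex) => -[|k] kd kmin.
  move: kd; rewrite expr0 invr1 => d1.
  have : `|x - y| <= 1 by rewrite ler_norml; lra.
  lra.
have dk : `|x - y| <= m%:R ^- k.
  by rewrite leNgt; apply/negP => /kmin; rewrite ltnn.
apply: le_trans (snake_modulus x01 y01 dk) _.
have -> : 2 * n%:R ^- k = 2 * n%:R * (m%:R ^- k.+1) `^ alpha :> R.
  by rewrite powR_exprnV ?(ltW m_gt0) // mn exprS invfM mulrA mulfK.
rewrite ler_pM2l ?mulr_gt0 //; apply: ge0_ler_powR => //; last exact: ltW.
  by rewrite nnegrE invr_ge0 exprn_ge0 // ltW.
Qed.

Lemma snake_continuous : {within `[0, 1], continuous snake}.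
Proof.
apply/subspace_continuousP => x; rewrite /= in_itv /= => x01.
apply/cvgrPdist_le => e e0.
have n2 : 2 <= n%:R :> R by rewrite ler_nat.
have cv : (fun k => n%:R^-1 ^+ k : R) @ \oo --> 0.
  apply: cvg_expr; rewrite gtr0_norm ?invr_gt0 // invf_lt1 //; lra.
have e2 : 0 < e / 2 by rewrite divr_gt0.
have /cvgr0Pnorm_lt /(_ _ e2) [k _ /(_ k (leqnn k))] := cv.
rewrite exprVn gtr0_norm ?invr_gt0 ?exprn_gt0 // => ke.
have mk0 : 0 < m%:R ^- k :> R by rewrite invr_gt0 exprn_gt0.
have near_x : \forall y \near x, `|x - y| <= m%:R ^- k.
  have /cvgrPdist_le := @cvg_id _ (nbhs x); exact.
rewrite near_withinE; near=> y; rewrite /= in_itv /= => y01.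
apply: le_trans (snake_modulus (k := k) x01 y01 _) _; last by lra.
by near: y.
Unshelve. all: by end_near. Qed.

(** * Self-affinity *)

Definition branch_map (i : nat) (v : 'rV[R]_2) : 'rV[R]_2 :=
  \row_j if j == 0 then (i%:R + v 0 0) / m%:R else branch i (v 0 1).

Lemma row2P (v w : 'rV[R]_2) : v 0 0 = w 0 0 -> v 0 1 = w 0 1 -> v = w.
Proof.
move=> e0 e1; apply/rowP => j.
have [->//|j1] : j = 0 \/ j = 1; last by rewrite j1.
by case: j => -[|[|//]] lt; [left | right]; exact: val_inj.
Qed.

Lemma branch_mapE0 i v : branch_map i v 0 0 = (i%:R + v 0 0) / m%:R.
Proof. by rewrite mxE. Qed.

Lemma branch_mapE1 i v : branch_map i v 0 1 = branch i (v 0 1).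
Proof. by rewrite mxE. Qed.

Lemma branch_map_affine i : affine_map (branch_map i).
Proof.
pose s : R := if odd (i %/ n) then - n%:R^-1 else n%:R^-1.
exists (diag_mx (\row_j if j == 0 then m%:R^-1 else s)),
  (branch_map i 0) => v.
rewrite mul_mx_diag; apply: row2P; rewrite !mxE /=.
  by rewrite addr0 mulrDl addrC.
by rewrite /branch /flip /s; case: odd; field; exact: n_neq0.
Qed.

Lemma branch_map_inj i : injective (branch_map i).
Proof.
move=> v w vw; apply: row2P.
  have := congr1 (fun u : 'rV[R]_2 => u 0 0) vw.
  by rewrite !branch_mapE0 => /(mulIf (invr_neq0 m_neq0)) /addrI.
have /eqP := congr1 (fun u : 'rV[R]_2 => u 0 1) vw.
rewrite !branch_mapE1 -subr_eq0 -normr_eq0 branch_dist mulf_eq0 invr_eq0.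
by rewrite (negPf n_neq0) orbF normr_eq0 subr_eq0 => /eqP.
Qed.

(** The map contracts horizontally by 1 / m and vertically by 1 / n, and n <= m. *)
Lemma branch_map_contractive i : contractive (branch_map i).
Proof.
exists n%:R^-1; first by rewrite invf_lt1 // ltr1n.
move=> v w; rewrite /euclidean_norm.
rewrite -[n%:R^-1]gtr0_norm ?invr_gt0 // -sqrtr_sqr -sqrtrM ?sqr_ge0 //.
apply: ler_wsqrtr; rewrite mulr_sumr; apply: ler_sum => j _.
rewrite -exprMn -[leLHS]real_normK ?num_real // -[leRHS]real_normK ?num_real //.
rewrite lerXn2r ?nnegrE //.
rewrite normrM (@gtr0_norm _ n%:R^-1) ?invr_gt0 // !mxE.
have [j0|j1] : j = 0 \/ j = 1.
  by case: j => -[|[|//]] lt; [left | right]; exact: val_inj.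
  rewrite j0 /= -mulrBl normrM (@gtr0_norm _ m%:R^-1) ?invr_gt0 //.
  rewrite opprD addrACA subrr add0r mulrC ler_wpM2r //.
  by rewrite lef_pV2 ?posrE // ler_nat.
by rewrite j1 /= branch_dist mulrC.
Qed.

Lemma graph_compact : compact (graph01 snake).
Proof.
(* In this form continuity into row vectors reduces to that of the coordinates. *)
pose g (x : R) : 'rV[R]_2 := x *: delta_mx 0 0 + snake x *: delta_mx 0 1.
have g0 x : g x 0 0 = x by rewrite !mxE /= mulr1 mulr0 addr0.
have g1 x : g x 0 1 = snake x by rewrite !mxE /= mulr1 mulr0 add0r.
have -> : graph01 snake = g @` `[0, 1].
  apply/seteqP; split=> [v [v01 vE]|_ [x x01 <-]].
    by exists (v 0 0) => //; apply: row2P; rewrite ?g0 ?g1.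
  by split; rewrite ?g0 ?g1.
apply: continuous_compact; last exact: segment_compact.
have /subspace_continuousP fc := snake_continuous.
apply/subspace_continuousP => x x01; apply: cvgD; apply: cvgZr_tmp.
  exact: cvg_within.
exact: fc.
Qed.

Lemma graph_union : graph01 snake =
  \bigcup_(i in [set: 'I_m]) (branch_map i @` graph01 snake).
Proof.
apply/seteqP; split=> [v [v01 vE]|_ [i _ [w [w01 wE] <-]]]; last first.
  move: w01; rewrite in_itv /= => w01; split.
    rewrite branch_mapE0 in_itv /= ler_pdivlMr // ler_pdivrMr // mul0r mul1r.
    have : (i.+1 <= m)%N by [].
    by rewrite -(ler_nat R) -natr1; have := ler0n R i; lra.
  by rewrite branch_mapE1 branch_mapE0 wE snake_branch.
move: v01; rewrite in_itv /= => /(@cell_exists 1) [a [t [am t01 _ aE]]].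
rewrite expn1 in am; rewrite expr1 in aE.
pose w : 'rV[R]_2 := \row_j if j == 0 then t else snake t.
have w0 : w 0 0 = t by rewrite mxE.
have w1 : w 0 1 = snake t by rewrite mxE.
exists (Ordinal am) => //; exists w.
  by split; rewrite ?w1 w0 ?in_itv.
apply: row2P; first by rewrite branch_mapE0 w0 aE.
by rewrite branch_mapE1 w1 vE aE snake_branch.
Qed.

Lemma snake_self_affine : self_affine_function snake.
Proof.
split; first exact: snake_continuous.
split; first exact: graph_compact.
exists m, (fun i : 'I_m => branch_map i); split.
- exact: leq_trans m_ge_n.
- move=> i; split; [exact: branch_map_affine | exact: branch_map_inj |].
  exact: branch_map_contractive.
- exact: graph_union.
Qed.

(** * Oscillation and box counting *)

(** The numbering of the rows describes the function: over column i of level s the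
graph stays in the row with number cell_row n q s i. *)
Lemma cell_row_itv s i (x : R) : (i < m ^ s)%N ->
  i%:R <= m%:R ^+ s * x < i.+1%:R ->
  (cell_row n q s i)%:R <= n%:R ^+ s * snake x <= (cell_row n q s i).+1%:R.
Proof.
elim: s i x => [|s IH] i x im; first by move=> _; rewrite expr0 mul1r; exact: snake01.
have ms0 : (0 < m ^ s)%N by rewrite expn_gt0 -(ltr0n R) m_gt0.
set d := (i %/ m ^ s)%N; set i' := (i %% m ^ s)%N.
have iE : i = (d * m ^ s + i')%N by exact: divn_eq.
have i'm : (i' < m ^ s)%N by rewrite ltn_mod.
pose t := m%:R * x - d%:R.
rewrite exprSr -mulrA.
have -> : m%:R * x = d%:R + t by rewrite addrC subrK.
have xE : x = (d%:R + t) / m%:R by rewrite /t addrC subrK mulrC mulKf.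
rewrite -natr1 {1 2}iE natrD natrM natrX mulrDr [d%:R * _]mulrC => xi.
have ms1 : 0 < m%:R ^+ s :> R by rewrite exprn_gt0.
have ti : i'%:R <= m%:R ^+ s * t < i'.+1%:R by rewrite -natr1; lra.
have t0 : 0 <= t.
  by rewrite -(pmulr_rge0 _ ms1); have := ler0n R i'; lra.
have t1 : t <= 1.
  rewrite -(ler_pM2l ms1) mulr1; move: i'm; rewrite -(ler_nat R) natrX; lra.
rewrite xE snake_branch ?t0 // /branch exprSr -mulrA.
rewrite [n%:R * _]mulrC divfK // mulrDr /= -/d -/i' natrD natrM natrX.
have := IH i' t i'm ti; have := cell_row_lt n_gt1 (odd_gt0 q_odd) s i'.
move: (cell_row n q s i') => r rn rt.
rewrite [(snake_row n d)%:R * _]mulrC -natr1 natrD natrM natrX.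
rewrite [(snake_row n d)%:R * _]mulrC.
have : 1 + r%:R <= n%:R ^+ s :> R by rewrite -natrX nat1r ler_nat.
rewrite -natr1 in rt; rewrite /flip; case: odd => ?; last by lra.
rewrite -subnDA natrB ?add1n // natrX -natr1; lra.
Qed.

(** All the values lie within n^-s of one of them, hence in at most 5 consecutive rows
of level s, and each row holds at most q^s columns. *)
Lemma oscillation_box_count (B : set R) s :
  (forall x y, B x -> B y -> `|snake x - snake y| <= n%:R ^- s) ->
  (box_count m B s <= 5 * q ^ s)%N.
Proof.
move=> osc; have mN0 : (0 < m)%N by rewrite -(ltr0n R).
have ns : 0 < n%:R ^+ s :> R by rewrite exprn_gt0.
have row_near x y i j : (i < m ^ s)%N -> (j < m ^ s)%N -> B x -> B y ->
    in_cell m s i x -> in_cell m s j y ->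
    (cell_row n q s i <= cell_row n q s j + 2)%N.
  move=> im jm Bx By; rewrite !in_cellE // => /(cell_row_itv im) xi.
  move=> /(cell_row_itv jm) yj.
  have := osc _ _ Bx By; rewrite -[leRHS]div1r ler_pdivlMr // mulrC.
  rewrite -{1}(gtr0_norm ns) -normrM ler_norml mulrBr => /andP[_ xy].
  by rewrite -(ler_nat R) natrD; rewrite -!natr1 in xi yj; lra.
rewrite box_countE; have [[i0 [i0m /asboolP [x0 Bx0 xi0]]]|no_hit] :=
    pselect (exists i0, (i0 < m ^ s)%N /\ meets_cell m B s i0); last first.
  rewrite big_mkord big1 // => i _; apply/eqP; rewrite eqb0; apply/negP => h.
  by case: no_hit; exists (val i); split=> //; exact: ltn_ord.
(* The five rows at distance at most 2 from that of column i0, indexed by c. *)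
apply: (@leq_trans (\sum_(0 <= i < m ^ s) \sum_(0 <= c < 5)
    (cell_row n q s i == (cell_row n q s i0 + c) - 2)))%N.
  rewrite !big_mkord; apply: leq_sum => i _.
  case: (boolP (meets_cell _ _ _ _)) => // /asboolP[x Bx xi].
  have le1 := row_near _ _ _ _ (ltn_ord i) i0m Bx Bx0 xi xi0.
  have le2 := row_near _ _ _ _ i0m (ltn_ord i) Bx0 Bx xi0 xi.
  have c5 : (cell_row n q s i + 2 - cell_row n q s i0 < 5)%N by lia.
  rewrite big_mkord (bigD1 (Ordinal c5)) //=.
  rewrite (_ : (_ == _) = true) //; apply/eqP; lia.
rewrite exchange_big_nat /= -[X in (_ <= X * _)%N]subn0 -sum_nat_const_nat.
by apply: leq_sum => c _; exact: cell_row_fiber n_gt1 (odd_gt0 q_odd) _ _.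
Qed.

Definition oscillating_cell (A : set R) (k s i : nat) : bool :=
  `[< exists x y, [/\ A x, A y, in_cell m k i x, in_cell m k i y
      & n%:R ^- (k + s) < `|snake x - snake y| ] >].

(** A column of level k that oscillates little is rescaled to the unit interval, where
oscillation_box_count applies; for the other columns all the m^s columns of level
k + s inside them are counted. *)
Lemma box_count_refine (A : set R) k s :
  (box_count m A (k + s) <= 5 * q ^ s * box_count m A k
     + m ^ s * \sum_(0 <= i < m ^ k) oscillating_cell A k s i)%N.
Proof.
have mN0 : (0 < m)%N by rewrite -(ltr0n R).
have mk : 0 < m%:R ^+ k :> R by rewrite exprn_gt0.
have ms : 0 < m%:R ^+ s :> R by rewrite exprn_gt0.
rewrite !box_countE expnD sum_nat_mul_split !big_distrr -big_split /= !big_mkord.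
apply: leq_sum => a _.
pose B : set R := [set t | 0 <= t < 1 /\ A ((a%:R + t) / m%:R ^+ k)].
have zoom b : (b < m ^ s)%N -> meets_cell m A (k + s) (a * m ^ s + b) ->
    meets_cell m B s b.
  move=> bm /asboolP [x Ax]; rewrite in_cellE // -addnS !natrD (natrM _ a) natrX.
  rewrite exprD => xi.
  have b1 : b.+1%:R <= m%:R ^+ s :> R by rewrite -natrX ler_nat.
  pose t := m%:R ^+ k * x - a%:R.
  have tE : m%:R ^+ k * m%:R ^+ s * x = m%:R ^+ s * t + a%:R * m%:R ^+ s.
    by rewrite /t; ring.
  have tb : b%:R <= m%:R ^+ s * t < b.+1%:R by rewrite tE in xi; lra.
  apply/asboolP; exists t; last by rewrite in_cellE.
  split; last by rewrite /t addrC subrK mulrC mulKf ?gt_eqF.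
  rewrite -(pmulr_rge0 _ ms) -(ltr_pM2l ms) mulr1.
  by have := ler0n R b; lra.
have meets_parent b : (b < m ^ s)%N ->
    meets_cell m A (k + s) (a * m ^ s + b) -> meets_cell m A k a.
  move=> bm /(zoom _ bm) /asboolP [t [t01 At] _].
  apply/asboolP; eexists; first exact: At.
  by rewrite in_cellE // mulrC divfK ?gt_eqF // -natr1; lra.
have [osc|/asboolPn no_osc] := boolP (oscillating_cell A k s a).
  rewrite muln1; apply: leq_trans (leq_addl _ _).
  apply: (@leq_trans (\sum_(0 <= b < m ^ s) 1)%N).
    by apply: leq_sum => b _; exact: leq_b1.
  by rewrite sum_nat_const_nat subn0 muln1.
rewrite muln0 addn0; have [_|no_hit] := boolP (meets_cell m A k a); last first.
  rewrite big_mkord big1 // => b _; apply/eqP; rewrite eqb0.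
  by apply: contra no_hit; exact: meets_parent.
rewrite muln1; apply: leq_trans (@oscillation_box_count B s _).
  rewrite box_countE !big_mkord; apply: leq_sum => b _.
  by case: (boolP (meets_cell m A _ _)) => // /(zoom _ (ltn_ord b)) ->.
move=> t u [t01 At] [u01 Au]; rewrite leNgt; apply/negP => lt_osc; apply: no_osc.
exists ((a%:R + t) / m%:R ^+ k), ((a%:R + u) / m%:R ^+ k).
split=> //; try by rewrite in_cellE // mulrC divfK ?gt_eqF // -natr1; lra.
rewrite snake_cell; [|exact: ltn_ord|lra|lra].
by rewrite exprD invfM mulrC ltr_pM2r // invr_gt0 exprn_gt0.
Qed.

Lemma holder_no_oscillation (A : set R) (beta : R) s :
  n%:R < m%:R `^ beta -> 0 <= beta -> holder_on A beta snake ->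
  exists k0, forall k i, (k0 <= k)%N -> oscillating_cell A k s i = false.
Proof.
have mN0 : (0 < m)%N by rewrite -(ltr0n R).
move=> nY beta0 [c c0 hol].
have e0 : 0 < (c * n%:R ^+ s)^-1 by rewrite invr_gt0 mulr_gt0 // exprn_gt0.
have [k0 k0P] := expr_ratio_lt (ltW n_gt0) nY e0.
exists k0 => k i /k0P nk; apply/negP => /asboolP [x [y [Ax Ay xi yi]]].
apply/negP; rewrite -leNgt; apply: le_trans (hol _ _ Ax Ay) _.
apply: (@le_trans _ _ (c * (m%:R `^ beta) ^- k)).
  rewrite ler_pM2l // -powR_exprnV ?(ltW m_gt0) //.
  apply: ge0_ler_powR => //; rewrite ?nnegrE ?invr_ge0 ?exprn_ge0 ?(ltW m_gt0) //.
  exact: in_cell_dist xi yi.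
have Yk : 0 < (m%:R `^ beta) ^+ k by rewrite exprn_gt0 // powR_gt0.
have nk0 : 0 < n%:R ^+ k :> R by rewrite exprn_gt0.
have ns0 : 0 < n%:R ^+ s :> R by rewrite exprn_gt0.
rewrite ler_pdivlMl ?mulr_gt0 // in nk.
by rewrite exprD ler_pdivrMr // ler_pdivlMl ?mulr_gt0 //; lra.
Qed.

(** * Dimension bounds *)

Let powR_lt (a b : R) : a < b -> m%:R `^ a < m%:R `^ b.
Proof.
move=> ab; rewrite -[b](subrK a) addrC powRD ?m_neq0 ?implybT //.
have powR1E : 1 `^ (b - a) = 1 :> R by rewrite powR1.
rewrite ltr_pMr ?powR_gt0 // -[ltLHS]powR1E.
by apply: gt0_ltr_powR; rewrite ?nnegrE ?subr_gt0 ?ler01 ?ltr1n // ltW.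
Qed.

Section Exponent.
Variable alpha : R.
Hypotheses (alpha_gt0 : 0 < alpha) (alpha_lt1 : alpha < 1)
  (alphaE : m%:R `^ alpha = n%:R).

Let powR_codim : m%:R `^ (1 - alpha) = q%:R.
Proof.
rewrite powRD ?m_neq0 ?implybT // powRr1 ?(ltW m_gt0) // powRN alphaE natrM.
by rewrite mulfK.
Qed.

Let snake_dim_le (A : set R) (M : nat) (D : R) :
  (2 <= M)%N -> 1 - alpha < D ->
  (forall s, exists (W : R) (k0 : nat), 0 <= W /\ forall k, (k0 <= k)%N ->
     (\sum_(0 <= i < m ^ k) oscillating_cell A k s i)%:R
       <= W * (m%:R `^ D) ^+ k) ->
  (upper_minkowski_dim M A <= D%:E)%E.
Proof.
move=> M2 aD osc.
have qX : q%:R < m%:R `^ D by rewrite -powR_codim powR_lt.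
have [||C C1 box_le] := @geometric_growth R (box_count m A) m q _ (ltnW m_gt1)
    (odd_gt0 q_odd) qX.
- by move=> k; exact: box_count_le.
- move=> s; have [W [k0 [W0 step]]] := osc s.
  have ms0 : 0 <= m%:R ^+ s :> R by rewrite exprn_ge0 // ltW.
  exists (m%:R ^+ s * W), k0; split=> [|k kk0]; first exact: mulr_ge0.
  have := box_count_refine A k s.
  rewrite -(ler_nat R) natrD (natrM _ (5 * _)) (natrM _ 5) (natrM _ (m ^ s)).
  move/le_trans; apply; rewrite !natrX lerD2l -mulrA ler_wpM2l //.
  exact: step.
apply: upper_minkowski_dim_le m_gt1 M2 _ C1 box_le.
by rewrite ltW // (lt_trans _ aD) // subr_gt0.
Qed.

Lemma snake_holder_dim (A : set R) (beta : R) (M : nat) :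
  (2 <= M)%N -> alpha < beta -> holder_on A beta snake ->
  (upper_minkowski_dim M A <= (1 - alpha)%:E)%E.
Proof.
move=> M2 ab hol; apply/lee_addgt0Pr => e e0; rewrite -EFinD.
apply: snake_dim_le => // [|s]; first lra.
have nY : n%:R < m%:R `^ beta by rewrite -alphaE powR_lt.
have beta0 : 0 <= beta by rewrite ltW // (lt_trans _ ab).
have [k0 no_osc] := @holder_no_oscillation A beta s nY beta0 hol.
exists 0, k0; split=> // k kk0; rewrite mul0r big1 // => i _.
by rewrite no_osc.
Qed.

Lemma snake_bounded_variation_dim (A : set R) (M : nat) :
  (2 <= M)%N -> bounded_variation_on A snake ->
  (upper_minkowski_dim M A <= (Num.max (1 - alpha) alpha)%:E)%E.
Proof.
move=> M2 [V0 V0_ub]; apply/lee_addgt0Pr => e e0; rewrite -EFinD.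
set D := Num.max _ _ + e.
have aD : alpha <= D.
  by rewrite (@le_trans _ _ (Num.max (1 - alpha) alpha)) ?le_max ?lexx ?orbT // lerDl ltW.
have caD : 1 - alpha < D.
  by rewrite (@le_lt_trans _ _ (Num.max (1 - alpha) alpha)) ?le_max ?lexx // ltrDl.
apply: snake_dim_le => // s.
have nX : n%:R <= m%:R `^ D.
  by rewrite -alphaE ler_powR // ler1n ltnW.
pose V := Num.max V0 0.
have V_ge0 : 0 <= V by rewrite /V le_max lexx orbT.
have V_ub v : variations_on A snake v -> v <= V.
  by move=> /V0_ub vV; rewrite /V le_max vV.
exists (V * n%:R ^+ s), 0%N; split=> [|k _].
  by rewrite mulr_ge0 // exprn_ge0 // ltW.
have nks : 0 < n%:R ^+ (k + s) :> R by rewrite exprn_gt0.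
have := @oscillation_sum_le_variation R A snake m k V (n%:R ^- (k + s))
  (oscillating_cell A k s) (m ^ k) (ltnW m_gt1) V_ge0 _ V_ub _.
rewrite ler_pdivrMl // => /(_ _ _) h.
apply: (@le_trans _ _ (n%:R ^+ (k + s) * V)).
  apply: h; first by rewrite invr_ge0 ltW.
  by move=> i /asboolP.
rewrite exprD -mulrA mulrC [_ * V]mulrC ler_wpM2l //.
  by rewrite mulr_ge0 // exprn_ge0 // ltW.
by rewrite lerXn2r // nnegrE ?powR_ge0 // ltW.
Qed.
End Exponent.

End Snake.

(** * Rational exponents *)

Lemma three_powR (R : realType) (p r : nat) : (0 < r)%N ->
  (3 ^ r)%:R `^ (p%:R / r%:R) = (3 ^ p)%:R :> R.
Proof.
move=> r0; have r_neq0 : r%:R != 0 :> R by rewrite pnatr_eq0 -lt0n.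
have three0 : 0 <= 3 :> R by [].
rewrite !natrX -!powR_mulrn // -powRrM; congr (_ `^ _).
by rewrite mulrC divfK.
Qed.

Lemma fraction_near (R : realType) (x d : R) : 0 <= x -> 0 < d ->
  exists p r : nat, [/\ (0 < p)%N, (0 < r)%N & x < p%:R / r%:R <= x + d].
Proof.
move=> x0 d0; pose r := (Num.truncn d^-1).+1.
have r0 : 0 < r%:R :> R by rewrite ltr0n.
have rd : 1 <= d * r%:R.
  have d1 : 0 <= d^-1 by rewrite invr_ge0 ltW.
  have /andP[_ /ltW dr] := truncn_itv d1.
  by rewrite mulrC -ler_pdivrMr // mul1r.
have xr0 : 0 <= x * r%:R by rewrite mulr_ge0 // ltW.
exists (Num.truncn (x * r%:R)).+1, r; split=> //.
have := truncn_itv xr0; rewrite ltr_pdivlMr // ler_pdivrMr // mulrDl -natr1; lra.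
Qed.

Theorem theorem1p2 (R : realType) :
  exists Delta : set R,
    [/\ Delta `<=` `]0, 1[,
        `]0, 1[ `<=` closure Delta &
        forall alpha : R, Delta alpha ->
          exists f : R -> R,
            [/\ self_affine_function f,
                holder_on `[0, 1] alpha f &
                forall A : set R, A !=set0 -> A `<=` `[0, 1] ->
                  ((exists2 beta : R, alpha < beta & holder_on A beta f) ->
                   forall M : nat, (2 <= M)%N ->
                     (upper_minkowski_dim M A <= (1 - alpha)%:E)%E) /\
                  (bounded_variation_on A f ->
                   forall M : nat, (2 <= M)%N ->
                     (upper_minkowski_dim M A
                        <= (Num.max (1 - alpha) alpha)%:E)%E)]].
Proof.
exists [set a | exists p r : nat, [/\ (0 < p)%N, (p < r)%N & a = p%:R / r%:R]].
have frac_lt1 (p r : nat) : (0 < r)%N -> (p%:R / r%:R < 1 :> R) = (p < r)%N.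
  by move=> r0; rewrite ltr_pdivrMr ?ltr0n // mul1r ltr_nat.
split.
- move=> _ [p [r [p0 pr ->]]]; have r0 : (0 < r)%N by exact: leq_trans pr.
  by rewrite /= in_itv /= frac_lt1 // pr divr_gt0 // ltr0n.
- move=> x; rewrite /= in_itv /= => /andP[x0 x1] B /nbhs_ballP [e /= e0 eB].
  (* The fraction has to stay below 1 and within e of x. *)
  pose d := Num.min (e / 2) ((1 - x) / 2).
  have d0 : 0 < d by rewrite lt_min !divr_gt0 // subr_gt0.
  have de : d < e by rewrite gt_min; apply/orP; left; lra.
  have d1 : d < 1 - x. by rewrite gt_min; apply/orP; right; lra.
  have [p [r [p0 r0 /andP[xp px]]]] := fraction_near (ltW x0) d0.
  exists (p%:R / r%:R); split.
    exists p, r; split=> //; rewrite -frac_lt1 //; lra.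
  apply: eB; rewrite -ball_normE /= ltr_norml; lra.
move=> alpha [p [r [p0 pr ->]]].
have r0 : (0 < r)%N by exact: leq_trans pr.
set n := (3 ^ p)%N; set q := (3 ^ (r - p))%N.
have n_gt1 : (1 < n)%N by rewrite -(expn0 3) ltn_exp2l.
have q_odd : odd q by rewrite oddX orbT.
have alphaE : (q * n)%:R `^ (p%:R / r%:R) = n%:R :> R.
  by rewrite -expnD subnK ?three_powR // ltnW.
have alpha0 : 0 < p%:R / r%:R :> R by rewrite divr_gt0 // ltr0n.
have alpha1 : p%:R / r%:R < 1 :> R by rewrite frac_lt1.
exists (@snake R n q); split.
- exact: snake_self_affine.
- exact: snake_holder (ltW alpha0) alphaE.
move=> A _ _; split=> [[beta ab hol] | bv] M M2.
- exact: snake_holder_dim hol.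
- exact: snake_bounded_variation_dim bv.
Qed.
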